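(* Let $\mathcal G$ be a fixed, connected, undirected graph on $N\ge 2$ nodes with Laplacian $L$ (largest eigenvalue $\lambda_N(L)$), let $0<\alpha<1/\lambda_N(L)$, $W=I_N-\alpha L$, let $\mathbf E_1,\dots,\mathbf E_N$ be the selector matrices of a block partition of $\mathbb R^d$ with block dimensions $d_1,\dots,d_N$, let $\mathbf P=\mathrm{blkdiag}(\mathbf E_1\mathbf E_1^\top,\dots,\mathbf E_N\mathbf E_N^\top)$, $\mathbf A_{\mathrm{sys}}=W\otimes I_d-\mathbf P$ and $\sigma=\|\mathbf A_{\mathrm{sys}}\|_2$. Let $\chi_i\in\mathbb R^N$ denote the $i$-th standard basis vector. For each coordinate $\ell\in\{1,\dots,d\}$, let $\zeta_\ell\in\mathbb R^d$ be the $\ell$-th standard basis vector and let $i$ be the agent owning coordinate $\ell$. Then the coordinate subspace $\{z\otimes\zeta_\ell:z\in\mathbb R^N\}$ is invariant under $\mathbf A_{\mathrm{sys}}$, and on it the operator acts as $W-\chi_i\chi_i^\top$, i.e. $\mathbf A_{\mathrm{sys}}(z\otimes\zeta_\ell)=\big((W-\chi_i\chi_i^\top)z\big)\otimes\zeta_\ell$. Hence $$\sigma=\max_{i:\,d_i\ge1}\big\|W-\chi_i\chi_i^\top\big\|_2 .$$ Thus, for a fixed set of owning agents $\{i:d_i\ge1\}$, $\sigma$ is independent of the total dimension $d$ and of the block dimensions $d_i$.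
   Context: Graphs are simple and unweighted; $L$ is the combinatorial graph Laplacian. $\|\cdot\|_2$ on matrices is the spectral norm. Selector matrices: $d=\sum_{i=1}^N d_i$ with $d\ge1$, vectors $u\in\mathbb R^d$ are partitioned as $u=[u_1^\top,\dots,u_N^\top]^\top$ with $u_i\in\mathbb R^{d_i}$, and $\mathbf E_i\in\{0,1\}^{d\times d_i}$ is the block-column of $I_d$ corresponding to the coordinates of $u_i$. Agent $i$ owns coordinate $\ell$ if $\ell$ is one of the coordinates of block $u_i$ (equivalently $\zeta_\ell$ is a column of $\mathbf E_i$); each coordinate has exactly one owner. $\otimes$ is the Kronecker product. *)

(* Defs.v *)
From HB Require Import structures.
From mathcomp Require Import all_boot all_order all_algebra.
From mathcomp Require Import mxtens.
From mathcomp Require Import classical_sets reals.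

Set Implicit Arguments.
Unset Strict Implicit.
Unset Printing Implicit Defensive.

Import Order.TTheory GRing.Theory Num.Theory.
Local Open Scope ring_scope.
Local Open Scope classical_set_scope.

Section Norms.
Variable R : realType.

Definition l2norm n (v : 'cV[R]_n) : R := Num.sqrt (\sum_i v i 0 ^+ 2).

Definition spectral_norm m n (A : 'M[R]_(m, n)) : R :=
  sup [set l2norm (A *m v) | v in [set v : 'cV[R]_n | l2norm v <= 1]].

Definition std_basis n (i : 'I_n) : 'cV[R]_n := delta_mx i 0.

(* The largest eigenvalue, for a matrix with at least one real eigenvalue. *)
Definition max_eigenvalue n (A : 'M[R]_n) : R :=
  sup [set a : R | eigenvalue A a].

End Norms.
Arguments std_basis {R n} i.

Definition simple_graph (T : finType) (e : rel T) : Prop :=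
  symmetric e /\ irreflexive e.

Definition connected_graph (T : finType) (e : rel T) : Prop :=
  forall x y, connect e x y.

Definition laplacian (R : realType) N (e : rel 'I_N) : 'M[R]_N :=
  \matrix_(i, j) if i == j then #|[set k | e i k]%SET|%:R else - (e i j)%:R.

Definition gossip_matrix (R : realType) N (e : rel 'I_N) (alpha : R) :
  'M[R]_N := 1%:M - alpha *: laplacian R e.

(* The block partition of R^d is given by the block dimensions d_, with
   d = \sum_i d_ i; coordinate k of block i is coordinate tagnat.Rank i k of
   R^d. *)
Section Partition.
Variables (R : realType) (N : nat) (d_ : 'I_N -> nat).
Local Notation d := (\sum_(i < N) d_ i)%N.

Definition selector (i : 'I_N) : 'M[R]_(d, d_ i) := submxrow 1%:M i.

Definition owner (l : 'I_d) : 'I_N := tagnat.sig1 l.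

Lemma ownerP (i : 'I_N) (l : 'I_d) :
  owner l = i <-> exists k : 'I_(d_ i), col k (selector i) = std_basis l.
Proof.
split=> [<-|[k /matrixP/(_ l 0)]].
  exists (tagnat.sig2 l); apply/matrixP=> x y.
  by rewrite !mxE (ord1 y) eqxx andbT tagnat.sig2K.
rewrite !mxE !eqxx; case: eqP => [-> _|_ /eqP].
  exact: tagnat.Rank1K.
by rewrite eq_sym oner_eq0.
Qed.

(* The library indexes \mxdiag by \sum_(i < N) n and the Kronecker product by
   N * n; both order the indices lexicographically as (block, position), so
   the cast keeps each index at its value. *)
Lemma sum_ord_const n : (\sum_(i < N) n = N * n)%N.
Proof. by rewrite sum_nat_const card_ord. Qed.

Definition blkdiag n (B : 'I_N -> 'M[R]_n) : 'M[R]_(N * n) :=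
  castmx (sum_ord_const n, sum_ord_const n) (\mxdiag_(i < N) B i).

Definition block_projector : 'M[R]_(N * d) :=
  blkdiag (fun i => selector i *m (selector i)^T).

Definition sys_matrix (e : rel 'I_N) (alpha : R) : 'M[R]_(N * d) :=
  gossip_matrix e alpha *t 1%:M - block_projector.

Definition sigma (e : rel 'I_N) (alpha : R) : R :=
  spectral_norm (sys_matrix e alpha).

Definition coord_subspace (l : 'I_d) : set 'cV[R]_(N * d) :=
  [set z *t (std_basis l : 'cV[R]_d) | z in [set: 'cV[R]_N]].

End Partition.
Arguments sys_matrix {R N} d_ e alpha.
Arguments sigma {R N} d_ e alpha.
Arguments coord_subspace R {N d_} l.

(* Main.v *)
Require Import Defs.
From HB Require Import structures.
From mathcomp Require Import all_boot all_order all_algebra.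
From mathcomp Require Import mxtens.
From mathcomp Require Import classical_sets reals.

Set Implicit Arguments.
Unset Strict Implicit.
Unset Printing Implicit Defensive.

Import Order.TTheory GRing.Theory Num.Theory.
Local Open Scope ring_scope.

(* Writing v in R^N (x) R^d as a sum of slices z_l (x) zeta_l, the squared norm
   of v is the sum of those of its slices, and the system matrix acts on the
   l-th slice as W - chi_i chi_i^T, where i owns l.  The spectral norm of such
   an orthogonal direct sum of operators is the maximum of their norms. *)

(** * Euclidean norm and spectral norm *)

Section SpectralNorm.
Variable R : realType.

Lemma l2norm_ge0 n (v : 'cV[R]_n) : 0 <= l2norm v.
Proof. exact: sqrtr_ge0. Qed.

Lemma l2norm_sqr n (v : 'cV[R]_n) : l2norm v ^+ 2 = \sum_i v i 0 ^+ 2.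
Proof. by rewrite sqr_sqrtr// sumr_ge0// => i _; rewrite sqr_ge0. Qed.

Lemma l2norm0 n : l2norm (0 : 'cV[R]_n) = 0.
Proof. by rewrite /l2norm big1 ?sqrtr0// => i _; rewrite mxE expr0n. Qed.

Lemma l2norm_eq0 n (v : 'cV[R]_n) : l2norm v = 0 -> v = 0.
Proof.
move=> v0; apply/matrixP => i j; rewrite (ord1 j) mxE.
have /eqP := l2norm_sqr v; rewrite v0 expr0n eq_sym psumr_eq0; last first.
  by move=> k _; rewrite sqr_ge0.
by move=> /allP/(_ i (mem_index_enum _)); rewrite sqrf_eq0 => /eqP.
Qed.

Lemma l2normZ n (a : R) (v : 'cV[R]_n) : l2norm (a *: v) = `|a| * l2norm v.
Proof.
rewrite /l2norm -sqrtr_sqr -sqrtrM ?sqr_ge0// mulr_sumr.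
by congr Num.sqrt; apply: eq_bigr => i _; rewrite mxE exprMn.
Qed.

Lemma le_l2norm n (v : 'cV[R]_n) (c : R) :
  0 <= c -> \sum_i v i 0 ^+ 2 <= c ^+ 2 -> l2norm v <= c.
Proof. by move=> c0; rewrite -l2norm_sqr ler_pXn2r ?nnegrE ?l2norm_ge0. Qed.

Lemma ler_norm_l2norm n (v : 'cV[R]_n) i : `|v i 0| <= l2norm v.
Proof.
rewrite -(@ler_pXn2r _ 2%N) ?nnegrE ?l2norm_ge0//.
rewrite l2norm_sqr real_normK ?num_real//.
by rewrite (bigD1 i)//= lerDl sumr_ge0// => k _; rewrite sqr_ge0.
Qed.

(** Each entry of [v] is at most its norm, so row [i] of [A *m v] is at most the absolute row sum
    times that norm. This crude constant only serves to bound above the set whose [sup] is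
    [spectral_norm A]. *)
Lemma l2norm_mulmx_bounded m n (A : 'M[R]_(m, n)) :
  exists2 C, 0 <= C & forall v, l2norm (A *m v) <= C * l2norm v.
Proof.
pose S := \sum_i (\sum_j `|A i j|) ^+ 2.
have S0 : 0 <= S by rewrite sumr_ge0// => i _; rewrite sqr_ge0.
exists (Num.sqrt S); first exact: sqrtr_ge0.
move=> v; apply: le_l2norm; first by rewrite mulr_ge0 ?sqrtr_ge0 ?l2norm_ge0.
rewrite exprMn sqr_sqrtr// mulr_suml; apply: ler_sum => i _.
rewrite -exprMn -[leLHS]real_normK ?num_real//.
have r0 : 0 <= \sum_j `|A i j| by rewrite sumr_ge0.
rewrite ler_pXn2r ?nnegrE ?mulr_ge0 ?l2norm_ge0//.
rewrite mxE (le_trans (ler_norm_sum _ _ _))// mulr_suml ler_sum// => j _.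
by rewrite normrM ler_wpM2l ?ler_norm_l2norm.
Qed.

Lemma spectral_norm_le m n (A : 'M[R]_(m, n)) (M : R) : 0 <= M ->
  (forall v, l2norm (A *m v) <= M * l2norm v) -> spectral_norm A <= M.
Proof.
move=> M0 AM; apply: ge_sup.
  (* The supremum bound requires a nonempty set; the zero vector supplies an element. *)
  by exists (l2norm (A *m 0)), 0 => //=; rewrite l2norm0 ler01.
move=> _ [v /= v1 <-]; apply: le_trans (AM v) _.
by rewrite -[leRHS]mulr1 ler_wpM2l.
Qed.

Lemma le_spectral_norm m n (A : 'M[R]_(m, n)) (v : 'cV[R]_n) :
  l2norm v <= 1 -> l2norm (A *m v) <= spectral_norm A.
Proof.
move=> v1; apply: ub_le_sup; last by exists v.
have [C C0 AC] := l2norm_mulmx_bounded A.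
exists C => _ [w /= w1 <-]; apply: le_trans (AC w) _.
by rewrite -[leRHS]mulr1 ler_wpM2l.
Qed.

Lemma spectral_norm_ge0 m n (A : 'M[R]_(m, n)) : 0 <= spectral_norm A.
Proof.
have := @le_spectral_norm _ _ A 0; rewrite mulmx0 !l2norm0; apply; exact: ler01.
Qed.

Lemma l2norm_mulmx m n (A : 'M[R]_(m, n)) (v : 'cV[R]_n) :
  l2norm (A *m v) <= spectral_norm A * l2norm v.
Proof.
have [/l2norm_eq0->|v0] := eqVneq (l2norm v) 0.
  by rewrite mulmx0 !l2norm0 mulr0.
have vgt0 : 0 < l2norm v by rewrite lt_def v0 l2norm_ge0.
rewrite -ler_pdivrMr//.
(* The bound on the unit ball is applied to [v] rescaled to norm 1. *)
have := @le_spectral_norm _ _ A ((l2norm v)^-1 *: v).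
rewrite -scalemxAr !l2normZ normfV ger0_norm ?l2norm_ge0// mulVf// mulrC.
by apply.
Qed.

End SpectralNorm.

(** * Indices of Kronecker products and of block matrices *)

Lemma sum_mxtens_index (V : nmodType) m n (F : 'I_(m * n) -> V) :
  \sum_k F k = \sum_(j < n) \sum_(i < m) F (mxtens_index (i, j)).
Proof.
rewrite exchange_big pair_big /=.
rewrite (reindex (fun p : 'I_m * 'I_n => mxtens_index p)) /=.
  by apply: eq_bigr => -[].
by exists (@mxtens_unindex m n) => k _; rewrite ?mxtens_indexK ?mxtens_unindexK.
Qed.

(** Both indices have value [i * n + k]: the rank counts the entries of the [i] earlier blocks, each
    of size [n]. *)
Lemma mxtens_index_Rank N n (i : 'I_N) (k : 'I_n) :
  cast_ord (esym (sum_ord_const N n)) (mxtens_index (i, k)) =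
  tagnat.Rank i k.
Proof.
apply: val_inj; rewrite [RHS]tagnat.RankEsum /= sum_nat_const; congr (_ * _ + _)%N.
rewrite -[LHS](card_ord i) -!sum1_card
  (big_ord_widen _ (fun _ => 1%N) (ltnW (ltn_ord i))).
by apply: eq_bigl => j.
Qed.

(** * Slices and direct sums of operators *)

Section Slices.
Variables (R : realType) (N d : nat).

(** With [v] read as an N by d array, this is its [l]-th column. *)
Definition slice (l : 'I_d) (v : 'cV[R]_(N * d)) : 'cV[R]_N :=
  \col_i v (mxtens_index (i, l)) 0.

Lemma sum_slice (v : 'cV[R]_(N * d)) :
  v = \sum_l slice l v *t (std_basis l : 'cV[R]_d).
Proof.
apply/matrixP => k j; case: (mxtens_indexP k) => i l.
rewrite summxE (bigD1 l)//= [X in _ + X]big1 => [|l' l'l].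
  by rewrite !mxE !mxtens_indexK !ord1 !eqxx mulr1 addr0.
by rewrite !mxE !mxtens_indexK /= eq_sym (negbTE l'l) mulr0.
Qed.

Lemma slice_tens (l l' : 'I_d) (z : 'cV[R]_N) :
  slice l (z *t (std_basis l' : 'cV[R]_d)) = (l == l')%:R *: z.
Proof.
by apply/matrixP => i j; rewrite !mxE !mxtens_indexK !ord1 eqxx andbT mulrC.
Qed.

Lemma sum_sqr_slice (v : 'cV[R]_(N * d)) :
  \sum_k v k 0 ^+ 2 = \sum_l \sum_i slice l v i 0 ^+ 2.
Proof.
rewrite sum_mxtens_index; apply: eq_bigr => l _.
by apply: eq_bigr => i _; rewrite mxE.
Qed.

Lemma l2norm_tens_basis (z : 'cV[R]_N) (l : 'I_d) :
  l2norm (z *t (std_basis l : 'cV[R]_d) : 'cV[R]_(N * d)) = l2norm z.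
Proof.
rewrite /l2norm sum_sqr_slice (bigD1 l)//= [X in _ + X]big1 => [|l' l'l].
  by rewrite slice_tens eqxx scale1r addr0.
by apply: big1 => i _; rewrite slice_tens (negbTE l'l) scale0r mxE expr0n.
Qed.

Lemma spectral_norm_slices (A : 'M[R]_(N * d)) (B : 'I_d -> 'M[R]_N) :
  (forall l (z : 'cV[R]_N), A *m (z *t (std_basis l : 'cV[R]_d)) =
               (B l *m z) *t (std_basis l : 'cV[R]_d)) ->
  spectral_norm A = \big[Num.max/0]_l spectral_norm (B l).
Proof.
move=> AB; apply/eqP; rewrite eq_le; apply/andP; split; last first.
  apply: bigmax_le => [|l _]; first exact: spectral_norm_ge0.
  apply: spectral_norm_le => [|z]; first exact: spectral_norm_ge0.
  (* Tensoring with a basis vector is an isometry, so [B l] inherits the bound of [A]. *)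
  by rewrite -(l2norm_tens_basis _ l) -AB -(l2norm_tens_basis z l) l2norm_mulmx.
set M := \big[_/_]_l _.
have M0 : 0 <= M by exact: bigmax_ge_id.
(* Expand [v] into slices; only the [l]-th summand has a nonzero [l]-th slice. *)
have sliceA l v : slice l (A *m v) = B l *m slice l v.
  rewrite {1}(sum_slice v) mulmx_sumr; apply/matrixP => i j.
  rewrite mxE summxE (bigD1 l)//= [X in _ + X]big1 => [|l' l'l]; rewrite AB.
    rewrite !mxE !mxtens_indexK !ord1 /= !eqxx mulr1 addr0.
    by apply: eq_bigr => k _; rewrite mxE.
  by rewrite !mxE !mxtens_indexK /= eq_sym (negbTE l'l) mulr0.
apply: spectral_norm_le => // v; apply: le_l2norm.
  by rewrite mulr_ge0 ?l2norm_ge0.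
(* By Pythagoras the squared norms split over the slices, and the bound is checked slice by
   slice. *)
rewrite exprMn l2norm_sqr !sum_sqr_slice mulr_sumr ler_sum// => l _.
rewrite sliceA -!l2norm_sqr -exprMn ler_pXn2r ?nnegrE ?mulr_ge0 ?l2norm_ge0//.
apply: le_trans (l2norm_mulmx _ _) _.
by rewrite ler_wpM2r ?l2norm_ge0// le_bigmax.
Qed.

End Slices.

(** * The system matrix on coordinate subspaces *)

Section SysMatrix.
Variables (R : realType) (N : nat).

Lemma blkdiagE n (B : 'I_N -> 'M[R]_n) i j k l :
  blkdiag B (mxtens_index (i, k)) (mxtens_index (j, l)) =
  (i == j)%:R * B i k l.
Proof.
rewrite castmxE /= !mxtens_index_Rank.
(* The entry is read inside block [(i, j)], which is [B i] on the diagonal and 0 off it. *)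
transitivity (submxblock (\mxdiag_(i < N) B i) i j k l).
  by rewrite [RHS]mxE.
rewrite mxblockK; case: eqVneq => [->|_]; last by rewrite mxE mul0r.
by rewrite conform_mx_id mul1r.
Qed.

Variables (d_ : 'I_N -> nat) (e : rel 'I_N) (alpha : R).
Local Notation d := (\sum_(i < N) d_ i)%N.

(** The product is the orthogonal projector onto the coordinates of block [i]. *)
Lemma selector_mul_tr_basis (i : 'I_N) (l : 'I_d) :
  selector R d_ i *m (selector R d_ i)^T *m (std_basis l : 'cV[R]_d) =
  (owner l == i)%:R *: (std_basis l : 'cV[R]_d).
Proof.
apply/matrixP => k j; rewrite (ord1 j) -mulmxA !mxE.
have trE (m : 'I_(d_ i)) :
    ((selector R d_ i)^T *m (std_basis l : 'cV[R]_d)) m 0 =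
    (tagnat.Rank i m == l)%:R.
  rewrite mxE (bigD1 l)//= [X in _ + X]big1 => [|l' l'l].
    by rewrite !mxE !eqxx /= mulr1 addr0 eq_sym.
  by rewrite !mxE (negbTE l'l) mulr0.
under eq_bigr do rewrite trE !mxE.
have [<-|li] := eqVneq (owner l) i; last first.
  rewrite mul0r big1// => m _; case: (tagnat.Rank i m =P l) => [lE|_]; last by rewrite mulr0.
  by move: li; rewrite -lE /owner tagnat.Rank1K eqxx.
(* The surviving term is the position of [l] inside its owner's block, unique since [tagnat.Rank] is
   injective. *)
rewrite mul1r andbT (bigD1 (tagnat.sig2 l))//= [X in _ + X]big1 => [|m ml].
  by rewrite (tagnat.sig2K l) eqxx mulr1 addr0.
case: (tagnat.Rank (owner l) m =P l) => [lE|_]; last by rewrite mulr0.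
case/eqP: ml; apply: val_inj; apply/eqP.
by have := tagnat.eq_Rank m (tagnat.sig2 l); rewrite lE tagnat.sig2K !eqxx.
Qed.

(** Block [i] of the tensor is [z i 0 *: std_basis l], which the [i]-th diagonal block keeps if [i]
    owns [l] and kills otherwise. *)
Lemma block_projector_tens (z : 'cV[R]_N) (l : 'I_d) :
  block_projector R d_ *m (z *t (std_basis l : 'cV[R]_d)) =
  (delta_mx (owner l) (owner l) *m z) *t (std_basis l : 'cV[R]_d).
Proof.
apply/matrixP => p j; case: (mxtens_indexP p) => i k.
(* In block row [i] only block column [i] contributes. *)
rewrite mxE sum_mxtens_index exchange_big (bigD1 i)//=.
rewrite [X in _ + X]big1 => [|i' i'i].
  rewrite addr0.
  under eq_bigr do rewrite blkdiagE eqxx mul1r [X in _ * X]mxE mxtens_indexK /= mulrCA.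
  rewrite -mulr_sumr [RHS]mxE mxtens_indexK /= !ord1.
  have /matrixP/(_ k 0) := selector_mul_tr_basis i l; rewrite mxE => ->.
  rewrite mxE mulrA; congr (_ * _).
  rewrite mxE (bigD1 (owner l))//= [X in _ + X]big1 => [|m ml].
    rewrite mxE eqxx andbT addr0 mulrC eq_sym.
    by case: eqP => [->|]; rewrite ?mul0r.
  by rewrite mxE (negbTE ml) andbF mul0r.
by apply: big1 => k' _; rewrite blkdiagE eq_sym (negbTE i'i) !mul0r.
Qed.

Lemma sys_matrix_tens (z : 'cV[R]_N) (l : 'I_d) :
  sys_matrix d_ e alpha *m (z *t (std_basis l : 'cV[R]_d)) =
  ((gossip_matrix e alpha -
    std_basis (owner l) *m (std_basis (owner l))^T) *m z)
    *t (std_basis l : 'cV[R]_d).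
Proof.
rewrite /sys_matrix; move: (gossip_matrix e alpha) => W.
rewrite mulmxBl tensmx_mul mul1mx block_projector_tens trmx_delta mul_delta_mx.
by apply/matrixP => p j; rewrite mulmxBl !mxE mulrBl.
Qed.

(** The maximum over coordinates regroups by owner: the owners are exactly the agents with a
    nonempty block. *)
Lemma sigmaE :
  sigma d_ e alpha =
  \big[Num.max/0]_(i < N | (1 <= d_ i)%N)
    spectral_norm
      (gossip_matrix e alpha - (std_basis i : 'cV[R]_N) *m (std_basis i)^T).
Proof.
rewrite /sigma (spectral_norm_slices (fun l z => sys_matrix_tens z l)).
apply/eqP; rewrite eq_le; apply/andP; split.
  apply: bigmax_le => [|l _]; first exact: bigmax_ge_id.
  (* The position of [l] in its owner's block shows that this block is nonempty. *)
  by apply: le_bigmax_cond; exact: leq_ltn_trans (ltn_ord (tagnat.sig2 l)).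
apply: bigmax_le => [|i di]; first exact: bigmax_ge_id.
(* The first coordinate of block [i] is a coordinate owned by [i]. *)
by rewrite (bigmax_sup (tagnat.Rank i (Ordinal di)))// /owner tagnat.Rank1K.
Qed.

End SysMatrix.

(* The maximum is seeded with 0, a lower bound of every norm; its range is
   nonempty because d > 0. *)
Theorem mainTheorem3 (R : realType) (N : nat) (e : rel 'I_N) (alpha : R)
    (d_ : 'I_N -> nat)
    (HN : (2 <= N)%N)
    (He : simple_graph e)
    (Hconn : connected_graph e)
    (Halpha0 : 0 < alpha)
    (Halpha1 : alpha < 1 / max_eigenvalue (laplacian R e))
    (Hd : (1 <= \sum_(i < N) d_ i)%N) :
  let W := gossip_matrix e alpha in
  let chi := fun i : 'I_N => (std_basis i : 'cV[R]_N) in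
  [/\ forall l : 'I_(\sum_(i < N) d_ i),
        (forall v, coord_subspace R l v ->
           coord_subspace R l (sys_matrix d_ e alpha *m v)) /\
        (forall z : 'cV[R]_N,
           sys_matrix d_ e alpha *m (z *t std_basis l) =
             ((W - chi (owner l) *m (chi (owner l))^T) *m z) *t std_basis l),
      sigma d_ e alpha =
        \big[Num.max/0]_(i < N | (1 <= d_ i)%N)
           spectral_norm (W - chi i *m (chi i)^T)
    & forall d'_ : 'I_N -> nat,
        (forall i, (1 <= d'_ i)%N = (1 <= d_ i)%N) ->
        sigma d'_ e alpha = sigma d_ e alpha].
Proof.
move=> W chi; split=> [l||d'_ dd'].
- split=> [_ [z _ <-]|z]; last exact: sys_matrix_tens.
  by rewrite sys_matrix_tens; eexists.
- exact: sigmaE.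
(* In [sigmaE] the block dimensions enter only through the index condition. *)
- by rewrite !sigmaE; apply: eq_bigl.
Qed.
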